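(* Let $h>0$ and let $\mathcal{BP}$ be the symmetric trigonal bipyramid in $E^3$ of interapex half-height $h$ with the five vertices $$x_1=(0,0,h),\quad x_2=(0,0,-h),\quad x_3=(1,0,0),\quad x_4=\left(-\tfrac12,\tfrac{\sqrt3}{2},0\right),\quad x_5=\left(-\tfrac12,-\tfrac{\sqrt3}{2},0\right).$$ (a) $\mathcal{BP}$ has no circumscribed cylinder when $h<\sqrt2/2$. (b) When $h\ge\sqrt2/2$, $\mathcal{BP}$ has six circumscribed cylinders. The axes are in the directions $$u=\left(0,\ \sqrt{\tfrac{2}{2h^2+1}},\ \pm\sqrt{\tfrac{2h^2-1}{2h^2+1}}\right),$$ which intersect at the point $c=\left(\tfrac{1}{4h^2+2},0,0\right)$, plus their rotated images of respective angles $2\pi/3$ and $4\pi/3$ around the interapex symmetry axis of order $3$. All six cylinders have radius $$\rho=\frac{4h^2+1}{4h^2+2}.$$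
   Context: $E^3$ is three-dimensional Euclidean space. A cylinder is the set of points at distance at most $\rho$ from a line called its axis, where $\rho\ge0$ is its radius. It is circumscribed to $\mathcal{BP}$ if all five vertices lie on its boundary. The apices of $\mathcal{BP}$ are $x_1$ and $x_2$, and the interapex symmetry axis of order $3$ is the line through them, i.e. the third coordinate axis, which is orthogonal to the equilateral triangular basis $x_3,x_4,x_5$.
   Formalization: At h = √2/2 the two signs in u give the same axis, so there are three distinct circumscribed cylinders rather than six; the count six is stated for h > √2/2 and three for h = √2/2, while the description of axes and radius holds for all h ≥ √2/2. *)

(* Defs.v *)
From HB Require Import structures.
From mathcomp Require Import all_boot all_order all_algebra.
From mathcomp Require Import all_classical all_reals all_analysis.
Set Implicit Arguments.
Unset Strict Implicit.
Unset Printing Implicit Defensive.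
Import Order.TTheory GRing.Theory Num.Theory.
Import numFieldNormedType.Exports.
Local Open Scope classical_set_scope.
Local Open Scope ring_scope.

Definition vec3 (R : realType) (a b c : R) : 'rV[R]_3 :=
  \row_(i < 3) [:: a; b; c]`_i.

(* The library norm `|x| on 'rV[R]_3 is the sup norm, hence an explicit
   Euclidean distance; both induce the same topology. *)
Definition eucl_dist (R : realType) (x y : 'rV[R]_3) : R :=
  Num.sqrt (\sum_(i < 3) (x 0 i - y 0 i) ^+ 2).

Definition dist_to (R : realType) (A : set 'rV[R]_3) (x : 'rV[R]_3) : R :=
  inf [set eucl_dist x y | y in A].

Definition line (R : realType) (p u : 'rV[R]_3) : set 'rV[R]_3 :=
  [set p + t *: u | t in [set: R]].

Definition is_line (R : realType) (L : set 'rV[R]_3) : Prop :=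
  exists p u : 'rV[R]_3, u != 0 /\ L = line p u.

Definition cylinder (R : realType) (L : set 'rV[R]_3) (rho : R) :
  set 'rV[R]_3 := [set x | dist_to L x <= rho].

Definition is_cylinder (R : realType) (C : set 'rV[R]_3) : Prop :=
  exists (L : set 'rV[R]_3) (rho : R),
    [/\ is_line L, 0 <= rho & C = cylinder L rho].

Definition boundary (T : topologicalType) (A : set T) : set T :=
  closure A `\` A°.

Definition bipyramid_vertices (R : realType) (h : R) : seq 'rV[R]_3 :=
  [:: vec3 0 0 h; vec3 0 0 (- h); vec3 1 0 0;
      vec3 (- (1 / 2)) (Num.sqrt 3 / 2) 0;
      vec3 (- (1 / 2)) (- (Num.sqrt 3 / 2)) 0].

Definition circumscribed (R : realType) (V : seq 'rV[R]_3)
    (C : set 'rV[R]_3) : Prop :=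
  forall x, x \in V -> boundary C x.

Definition circumscribed_cylinders (R : realType) (V : seq 'rV[R]_3) :
  set (set 'rV[R]_3) := [set C | is_cylinder C /\ circumscribed V C].

Definition rotz (R : realType) (theta : R) (x : 'rV[R]_3) : 'rV[R]_3 :=
  vec3 (cos theta * x 0 0 - sin theta * x 0 1)
       (sin theta * x 0 0 + cos theta * x 0 1)
       (x 0 2).

(* Main.v *)
Require Import Defs.
From HB Require Import structures.
From mathcomp Require Import all_boot all_order all_algebra.
From mathcomp Require Import all_classical all_reals all_analysis.
From mathcomp Require Import ring lra.
Set Implicit Arguments.
Unset Strict Implicit.
Unset Printing Implicit Defensive.
Import Order.TTheory GRing.Theory Num.Theory.
Import numFieldNormedType.Exports.
Local Open Scope classical_set_scope.
Local Open Scope card_scope.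
Local Open Scope ring_scope.

(** A line can be written [line p u] with [u] a unit vector and [p] the foot of
    the perpendicular from the origin, so that [p] is orthogonal to [u].  By
    Pythagoras the squared distance from [x] to it is
      [|x - p|^2 - ((x - p).u)^2 = |x|^2 - 2 x.p + |p|^2 - (x.u)^2],
    and the boundary of the cylinder of radius [rho] is the set where this
    equals [rho^2] ([boundary_cylinder]).  A circumscribed cylinder is thus a
    line equidistant from the five vertices.

    Write [u = (a, b, c)] ([equidistant_bipyramid]).  Equality at the two apices
    forces [p_z = 0].  At the base vertex of polar angle [theta], the angles
    [2 theta] and [- theta] agree up to full turns, so the equation is a linear
    combination of [1], [cos theta], [sin theta] that vanishes at three points;
    its coefficients are therefore zero, which gives
      [p = ((b^2 - a^2) / 4, a b / 2, 0)]
    and [rho^2 = 1 + |p|^2 - (a^2 + b^2) / 2].  Comparing with the apices gives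
    [a^2 + b^2 = 2 / (2 h^2 + 1)], which a unit vector allows exactly when
    [2 h^2 >= 1]: this is the threshold.  Finally [p.u = 0] becomes
    [a (3 b^2 - a^2) = 0]: the horizontal part of [u] lies on one of three lines
    at mutual angles of [pi / 3], exchanged by the rotation of order 3.  With
    the sign of [c] this leaves six axes ([circumscribed_axis_classification]).

    To count cylinders as sets of points, one has to recover the axis from the
    cylinder.  A line contained in a cylinder is parallel to its axis
    ([parallel_of_line_sub_cylinder]), and the six axes are pairwise
    non-parallel above the threshold ([axis_cylinder_inj]).  At the threshold
    [c = 0] and the axes coincide in pairs. *)

(** * Coordinates *)

Lemma sum_ord3 (V : nmodType) (F : 'I_3 -> V) :
  \sum_(i < 3) F i = F 0 + F 1 + F 2.
Proof.
rewrite !big_ord_recl big_ord0 addr0 addrA.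
by congr (F _ + F _ + F _); apply: val_inj.
Qed.

Lemma vec3E (R : realType) (a b c : R) :
  (vec3 a b c 0 0 = a) * (vec3 a b c 0 1 = b) * (vec3 a b c 0 2 = c).
Proof. by rewrite !mxE. Qed.

Lemma ord3P (P : 'I_3 -> Prop) : P 0 -> P 1 -> P 2 -> forall k, P k.
Proof.
move=> P0 P1 P2 [[|[|[|//]]] i].
- by rewrite (_ : Ordinal i = 0) //; apply: val_inj.
- by rewrite (_ : Ordinal i = 1) //; apply: val_inj.
- by rewrite (_ : Ordinal i = 2) //; apply: val_inj.
Qed.

Lemma row3P (R : realType) (x y : 'rV[R]_3) :
  x 0 0 = y 0 0 -> x 0 1 = y 0 1 -> x 0 2 = y 0 2 -> x = y.
Proof. by move=> e0 e1 e2; apply/rowP; apply: ord3P. Qed.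

(** * Distance to a line and boundary of a cylinder *)

Definition dotv (R : realType) (x y : 'rV[R]_3) : R :=
  \sum_(i < 3) x 0 i * y 0 i.

(** For a unit vector [u], this is the squared distance from [x] to the line
    through [p] directed by [u]. *)
Definition axis_sqdist (R : realType) (p u x : 'rV[R]_3) : R :=
  dotv (x - p) (x - p) - dotv (x - p) u ^+ 2.

Lemma dotvE (R : realType) (x y : 'rV[R]_3) :
  dotv x y = x 0 0 * y 0 0 + x 0 1 * y 0 1 + x 0 2 * y 0 2.
Proof. exact: sum_ord3. Qed.

Lemma dotv_gt0 (R : realType) (x : 'rV[R]_3) : x != 0 -> 0 < dotv x x.
Proof.
apply: contraNT; rewrite -leNgt => xx0.
have := sqr_ge0 (x 0 0); have := sqr_ge0 (x 0 1); have := sqr_ge0 (x 0 2).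
rewrite dotvE in xx0 => h2 h1 h0.
by apply/eqP/row3P; rewrite !mxE; apply/eqP; rewrite -sqrf_eq0;
  apply/eqP; lra.
Qed.

(** Pythagoras: the orthogonal projection of [x] on the line has parameter
    [dotv (x - p) u], so the infimum defining the distance is a minimum. *)
Lemma sqdist_line_point (R : realType) (p u x : 'rV[R]_3) (t : R) :
  dotv u u = 1 ->
  \sum_(i < 3) (x 0 i - (p + t *: u) 0 i) ^+ 2 =
  axis_sqdist p u x + (t - dotv (x - p) u) ^+ 2.
Proof.
move=> u1; transitivity (axis_sqdist p u x + (t - dotv (x - p) u) ^+ 2
                         + t ^+ 2 * (dotv u u - 1)).
  by rewrite sum_ord3 /axis_sqdist !dotvE !mxE; ring.
by rewrite u1 subrr mulr0 addr0.
Qed.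

Lemma axis_sqdist_ge0 (R : realType) (p u x : 'rV[R]_3) :
  dotv u u = 1 -> 0 <= axis_sqdist p u x.
Proof.
move=> u1; have := sqdist_line_point p x (dotv (x - p) u) u1.
rewrite subrr expr0n addr0 => <-.
by apply: sumr_ge0 => i _; rewrite sqr_ge0.
Qed.

Lemma dist_to_line (R : realType) (p u x : 'rV[R]_3) :
  dotv u u = 1 -> dist_to (line p u) x = Num.sqrt (axis_sqdist p u x).
Proof.
move=> u1; rewrite /dist_to.
set E := [set _ | _ in _].
have lbE : lbound E (Num.sqrt (axis_sqdist p u x)).
  move=> _ [_ [t _ <-] <-]; rewrite /eucl_dist sqdist_line_point //.
  by apply: ler_wsqrtr; rewrite lerDl sqr_ge0.
have mE : E (Num.sqrt (axis_sqdist p u x)).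
  exists (p + dotv (x - p) u *: u); first by exists (dotv (x - p) u).
  by rewrite /eucl_dist sqdist_line_point // subrr expr0n addr0.
apply/eqP; rewrite eq_le; apply/andP; split.
- by apply: ge_inf => //; exists (Num.sqrt (axis_sqdist p u x)).
- by apply: lb_le_inf => //; exists (Num.sqrt (axis_sqdist p u x)).
Qed.

Lemma cylinder_lineE (R : realType) (p u : 'rV[R]_3) (rho : R) :
  dotv u u = 1 -> 0 <= rho ->
  cylinder (line p u) rho = [set x | axis_sqdist p u x <= rho ^+ 2].
Proof.
move=> u1 rho0; apply/seteqP; split => x; rewrite /cylinder /= dist_to_line //.
  by rewrite -{2}(sqr_sqrtr (axis_sqdist_ge0 p x u1)) ler_sqr ?nnegrE
             ?sqrtr_ge0.
by move=> le; rewrite -(ger0_norm rho0) -sqrtr_sqr ler_wsqrtr.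
Qed.

Lemma axis_sqdist_continuous (R : realType) (p u : 'rV[R]_3) :
  continuous (axis_sqdist p u).
Proof.
have addC (T : topologicalType) (f g : T -> R) : continuous f ->
    continuous g -> continuous (fun x => f x + g x).
  by move=> cf cg x; apply: cvgD; [exact: cf | exact: cg].
have mulC (T : topologicalType) (f g : T -> R) : continuous f ->
    continuous g -> continuous (fun x => f x * g x).
  by move=> cf cg x; apply: cvgM; [exact: cf | exact: cg].
have coord (i : 'I_3) : continuous (fun x : 'rV[R]_3 => (x - p) 0 i).
  under eq_fun do rewrite !mxE.
  by apply: addC; [exact: coord_continuous | exact: cst_continuous].
have cu (i : 'I_3) : continuous (fun _ : 'rV[R]_3 => u 0 i).
  exact: cst_continuous.
have dot (f g : 'rV[R]_3 -> 'rV[R]_3) :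
    (forall i, continuous (fun x => f x 0 i)) ->
    (forall i, continuous (fun x => g x 0 i)) ->
    continuous (fun x => dotv (f x) (g x)).
  move=> cf cg; rewrite (_ : (fun x => _) = (fun x => f x 0 0 * g x 0 0 +
      f x 0 1 * g x 0 1 + f x 0 2 * g x 0 2)).
    have m i := mulC _ _ _ (cf i) (cg i).
    exact: addC _ _ _ (addC _ _ _ (m 0) (m 1)) (m 2).
  by apply/funext => x; rewrite dotvE.
rewrite (_ : axis_sqdist p u = (fun x => dotv (x - p) (x - p) +
    -1 * (dotv (x - p) u * dotv (x - p) u))).
  have c1 := dot _ _ coord coord; have c2 := dot _ _ coord cu.
  have cN : continuous (fun _ : 'rV[R]_3 => -1 : R) by exact: cst_continuous.
  exact: addC _ _ _ c1 (mulC _ _ _ cN (mulC _ _ _ c2 c2)).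
by apply/funext => x; rewrite /axis_sqdist mulN1r expr2.
Qed.

(** The squared distance to a line is convex along every direction, and strictly
    convex along a direction [n] not parallel to the line; such a function
    increases when one leaves [x] along [n] or along [- n].  Hence a point at
    distance exactly [rho] is never interior to the cylinder, even when
    [rho = 0]. *)
Lemma axis_sqdist_escape (R : realType) (p u x : 'rV[R]_3) :
  dotv u u = 1 ->
  exists n : 'rV[R]_3, forall t, 0 < t ->
    axis_sqdist p u x < axis_sqdist p u (x + t *: n).
Proof.
move=> u1.
(* The three basis vectors have squared distances to the direction [u] that add
   up to 3 - 1 = 2, so one of them is positive. *)
have [n n0] : exists n, 0 < dotv n n - dotv n u ^+ 2.
  have e : (dotv (vec3 1 0 0) (vec3 1 0 0) - dotv (vec3 1 0 0) u ^+ 2) +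
    (dotv (vec3 0 1 0) (vec3 0 1 0) - dotv (vec3 0 1 0) u ^+ 2) +
    (dotv (vec3 0 0 1) (vec3 0 0 1) - dotv (vec3 0 0 1) u ^+ 2) = 2.
    transitivity (3 - dotv u u); last by rewrite u1; ring.
    by rewrite !dotvE !vec3E; ring.
  have [?|h1] := ltP 0 (dotv (vec3 1 0 0) (vec3 1 0 0) -
                      dotv (vec3 1 0 0) u ^+ 2); first by eexists; eassumption.
  have [?|h2] := ltP 0 (dotv (vec3 0 1 0) (vec3 0 1 0) -
                      dotv (vec3 0 1 0) u ^+ 2); first by eexists; eassumption.
  exists (vec3 0 0 1); lra.
(* The sign of [B], half the derivative at [x] along [n], tells which of [n] and
   [- n] points outwards. *)
pose B := dotv (x - p) n - dotv (x - p) u * dotv n u.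
have expand s t : axis_sqdist p u (x + t *: (s *: n)) =
    axis_sqdist p u x + 2 * (t * (s * B)) +
    (t * s) ^+ 2 * (dotv n n - dotv n u ^+ 2).
  rewrite /B /axis_sqdist !dotvE !mxE; ring.
exists ((if 0 <= B then 1 else -1) *: n) => t t0.
rewrite expand -addrA ltrDl; apply: ltr_wpDl.
  rewrite pmulr_rge0 // pmulr_rge0 //.
  by case: ifP => [|/negbT]; rewrite ?mul1r // -ltNge mulN1r oppr_ge0 => /ltW.
rewrite mulr_gt0 // exprn_even_gt0 //=.
apply: mulf_neq0; first by rewrite gt_eqF.
by case: ifP => _; rewrite ?oppr_eq0 oner_eq0.
Qed.

Lemma boundary_cylinder (R : realType) (p u : 'rV[R]_3) (rho : R) :
  dotv u u = 1 -> 0 <= rho ->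
  boundary (cylinder (line p u) rho) = [set x | axis_sqdist p u x = rho ^+ 2].
Proof.
move=> u1 rho0; rewrite cylinder_lineE // /boundary.
have fc := @axis_sqdist_continuous R p u.
have clC : closed [set x | axis_sqdist p u x <= rho ^+ 2].
  exact: (preimage_closed _ (closed_le (y := rho ^+ 2))).
rewrite -(iffLR (closure_id _) clC).
apply/seteqP; split=> x /=.
  move=> [xle nint]; apply/eqP; rewrite eq_le xle /= leNgt; apply/negP => xlt.
  apply: nint.
  have op : open [set x | axis_sqdist p u x < rho ^+ 2].
    by apply: (open_comp _ (open_lt (y := rho ^+ 2))) => ? _; exact: fc.
  rewrite /interior /=; apply: filterS (open_nbhs_nbhs (conj op xlt)).
  by move=> y /= /ltW.
move=> xE; split; first by rewrite xE.
move=> xint.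
have [n esc] := axis_sqdist_escape p x u1.
have cn : (fun t : R => x + t *: n) @ 0 --> x.
  rewrite -[X in _ --> X]addr0 -[X in _ + X](scale0r n).
  apply: cvgD; first exact: cvg_cst.
  by apply: cvgZr_tmp; exact: cvg_id.
have /nbhs_ballP[e /= e0 he] := cn _ xint.
have e20 : 0 < e / 2 by rewrite divr_gt0.
have /he /= : ball (0 : R) e (e / 2).
  by rewrite /ball /= sub0r normrN gtr0_norm // ltr_pdivrMr // ltr_pMr // ltr1n.
by rewrite leNgt -xE esc.
Qed.

(** * Lines equidistant from the five vertices *)

Lemma line_reparam (R : realType) (p u : 'rV[R]_3) (s k : R) :
  k != 0 -> line (p + s *: u) (k *: u) = line p u.
Proof.
move=> k0; apply/seteqP; split=> x [t _ <-].
  by exists (s + t * k); rewrite // scalerDl scalerA addrA.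
exists ((t - s) / k); rewrite // scalerA divfK // -addrA -scalerDl.
by rewrite [s + _]addrC subrK.
Qed.

Lemma is_line_normal_form (R : realType) (L : set 'rV[R]_3) : is_line L ->
  exists p u, [/\ dotv u u = 1, dotv p u = 0 & L = line p u].
Proof.
move=> [p [u [u0 ->]]]; have uu0 := dotv_gt0 u0.
pose k := (Num.sqrt (dotv u u))^-1.
have k0 : k != 0 by rewrite invr_eq0 sqrtr_eq0 -ltNge.
have kku : k ^+ 2 * dotv u u = 1.
  by rewrite exprVn sqr_sqrtr ?ltW // mulVf // gt_eqF.
exists (p + (- (dotv p u / dotv u u)) *: u), (k *: u); split.
- by rewrite -kku !dotvE !mxE; ring.
- have bilin c : dotv (p + c *: u) (k *: u) = k * (dotv p u + c * dotv u u).
    by rewrite !dotvE !mxE; ring.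
  by rewrite bilin mulNr divfK ?gt_eqF // subrr mulr0.
- by rewrite line_reparam.
Qed.

Lemma circumscribedE (R : realType) (V : seq 'rV[R]_3) (p u : 'rV[R]_3)
    (rho : R) : dotv u u = 1 -> 0 <= rho ->
  circumscribed V (cylinder (line p u) rho) <->
  (forall x, x \in V -> axis_sqdist p u x = rho ^+ 2).
Proof. by move=> u1 rho0; rewrite /circumscribed boundary_cylinder. Qed.

Lemma axis_sqdistE (R : realType) (p u x : 'rV[R]_3) : dotv p u = 0 ->
  axis_sqdist p u x = dotv x x - 2 * dotv x p + dotv p p - dotv x u ^+ 2.
Proof.
move=> pu; rewrite /axis_sqdist (_ : dotv (x - p) u = dotv x u - dotv p u).
  by rewrite pu subr0 !dotvE !mxE; ring.
by rewrite !dotvE !mxE; ring.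
Qed.

(** The value of [u_x^2 + u_y^2] for the unit direction [u] of a circumscribed
    cylinder; the hypothesis [horiz_sqnorm h <= 1] used below says that such a
    unit vector exists. *)
Definition horiz_sqnorm (R : realType) (h : R) : R := 2 / (2 * h ^+ 2 + 1).

Definition circumradius (R : realType) (h : R) : R :=
  (4 * h ^+ 2 + 1) / (4 * h ^+ 2 + 2).

(** The five equations in [p] and [u] are solved explicitly: the two apices give
    [p 0 2], the two base vertices exchanged by the reflection [y -> - y] give
    [p 0 1], the third base vertex then gives [p 0 0], and comparing apices with
    base gives the length of the horizontal part of [u].  The cubic equation
    is [dotv p u = 0] after substitution of [p]. *)
Lemma equidistant_bipyramid (R : realType) (h r : R) (p u : 'rV[R]_3) :
  0 < h -> dotv u u = 1 -> dotv p u = 0 ->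
  (forall x, x \in bipyramid_vertices h -> axis_sqdist p u x = r) <->
  [/\ p = vec3 ((u 0 1 ^+ 2 - u 0 0 ^+ 2) / 4) (u 0 0 * u 0 1 / 2) 0,
      u 0 0 * (3 * u 0 1 ^+ 2 - u 0 0 ^+ 2) = 0,
      u 0 0 ^+ 2 + u 0 1 ^+ 2 = horiz_sqnorm h &
      r = circumradius h ^+ 2].
Proof.
move=> h0 u1 pu.
set s : R := Num.sqrt 3.
have s2 : s ^+ 2 = 3 by rewrite sqr_sqrtr.
have s0 : s != 0 by rewrite gt_eqF // sqrtr_gt0.
have hh0 : 0 < h ^+ 2 by rewrite exprn_gt0.
have hne : 2 * h ^+ 2 + 1 != 0 by rewrite gt_eqF //; lra.
have hne' : 4 * h ^+ 2 + 2 != 0 by rewrite gt_eqF //; lra.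
have wE : (2 * h ^+ 2 + 1) * horiz_sqnorm h = 2.
  by rewrite /horiz_sqnorm mulrC divfK.
have rE : circumradius h ^+ 2 =
    h ^+ 2 * horiz_sqnorm h + horiz_sqnorm h ^+ 2 / 16.
  by rewrite /circumradius /horiz_sqnorm; field; rewrite hne hne'.
have -> : (forall x, x \in bipyramid_vertices h -> axis_sqdist p u x = r) <->
  [/\ axis_sqdist p u (vec3 0 0 h) = r, axis_sqdist p u (vec3 0 0 (- h)) = r,
      axis_sqdist p u (vec3 1 0 0) = r,
      axis_sqdist p u (vec3 (- (1 / 2)) (s / 2) 0) = r &
      axis_sqdist p u (vec3 (- (1 / 2)) (- (s / 2)) 0) = r].
  split=> [eq_r|[e1 e2 e3 e4 e5] x].
    by split; apply: eq_r; rewrite !inE eqxx ?orbT.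
  by rewrite !inE => /or4P[/eqP->|/eqP->|/eqP->|/orP[/eqP->|/eqP->]].
rewrite !axis_sqdistE // !dotvE !vec3E.
rewrite !dotvE in u1 pu.
have pE : p = vec3 (p 0 0) (p 0 1) (p 0 2) by apply: row3P; rewrite vec3E.
have -> : (p = vec3 ((u 0 1 ^+ 2 - u 0 0 ^+ 2) / 4) (u 0 0 * u 0 1 / 2) 0) =
  [/\ p 0 0 = (u 0 1 ^+ 2 - u 0 0 ^+ 2) / 4, p 0 1 = u 0 0 * u 0 1 / 2 &
      p 0 2 = 0].
  rewrite propeqE; split=> [->|[e0 e1 e2]]; first by rewrite !vec3E.
  by apply: row3P; rewrite vec3E.
move: pu u1; move: (p 0 0) (p 0 1) (p 0 2) (u 0 0) (u 0 1) (u 0 2).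
move=> x y z a b c pu u1 {pE}.
(* The two nonlinear consequences of [s ^+ 2 = 3] and [u1] that make the rest
   linear in the monomials. *)
have sb : s ^+ 2 * b ^+ 2 = 3 * b ^+ 2 by rewrite s2.
have hu : h ^+ 2 * (a * a + b * b + c * c) = h ^+ 2 by rewrite u1 mulr1.
split.
- move=> [e1 e2 e3 e4 e5].
  have z0 : z = 0.
    by apply: (mulfI (lt0r_neq0 h0)); rewrite mulr0; lra.
  have yE : y = a * b / 2 by apply: (mulfI s0); lra.
  have xE : x = (b ^+ 2 - a ^+ 2) / 4 by lra.
  have wE' : a ^+ 2 + b ^+ 2 = horiz_sqnorm h.
    apply: (mulfI hne); rewrite wE; subst z; lra.
  split=> //.
    move: pu; rewrite xE yE z0; lra.
  rewrite rE -wE' -e1 xE yE z0.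
  move: hu; rewrite !expr2; lra.
- move=> [[-> -> ->] hA wE' ->]; rewrite rE -wE'.
  have wh : (2 * h ^+ 2 + 1) * (a ^+ 2 + b ^+ 2) = 2 by rewrite wE'.
  split; lra.
Qed.

(** * The six axes *)

Lemma rotz_line (R : realType) (theta : R) (p u : 'rV[R]_3) :
  rotz theta @` line p u = line (rotz theta p) (rotz theta u).
Proof.
have lin t : rotz theta (p + t *: u) = rotz theta p + t *: rotz theta u.
  by apply: row3P; rewrite !mxE /=; ring.
apply/seteqP; split=> x.
  by move=> [_ [t _ <-] <-]; exists t; rewrite // lin.
by move=> [t _ <-]; exists (p + t *: u); [exists t | rewrite lin].
Qed.

(** The angle is in the second quadrant and its triple is a full turn, so the
    triple angle formula for the sine gives [4 cos^2 = 1]. *)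
Lemma cos_sin_third_turn (R : realType) :
  cos (2 * pi / 3 : R) = - (1 / 2) /\ sin (2 * pi / 3 : R) = Num.sqrt 3 / 2.
Proof.
set t := 2 * pi / 3 : R.
have pi0 : 0 < pi :> R by exact: pi_gt0.
have s0 : 0 < sin t by rewrite sin_gt0_pi // /t; lra.
have c0 : cos t < 0.
  have -> : t = (t - pi / 2) + pi / 2 by ring.
  by rewrite cosDpihalf oppr_lt0 sin_gt0_pihalf // /t; lra.
have s2 := sin2cos2 t.
have : sin (t *+ 2 + t) = 0.
  by rewrite (_ : t *+ 2 + t = pi *+ 2) ?sin2pi // /t; field.
rewrite sinD sin_mulr2n cos_mulr2n => e.
have cE : cos t = - (1 / 2).
  have : sin t * ((2 * cos t - 1) * (2 * cos t + 1)) = 0.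
    by rewrite -e; ring.
  move/eqP; rewrite !mulf_eq0 gt_eqF //= => /orP[] /eqP; lra.
split=> //; have -> : Num.sqrt 3 = Num.sqrt ((sin t * 2) ^+ 2) :> R.
  by congr Num.sqrt; rewrite exprMn s2 cE; lra.
by rewrite sqrtr_sqr ger0_norm ?mulfK // mulr_ge0 // ltW.
Qed.

Definition axis_point (R : realType) (h : R) (k : 'I_3) : 'rV[R]_3 :=
  rotz (k%:R * (2 * pi / 3)) (vec3 (1 / (4 * h ^+ 2 + 2)) 0 0).

Definition axis_dir (R : realType) (h : R) (k : 'I_3) (s : bool) : 'rV[R]_3 :=
  rotz (k%:R * (2 * pi / 3))
    (vec3 0 (Num.sqrt (horiz_sqnorm h))
       ((-1) ^+ s * Num.sqrt ((2 * h ^+ 2 - 1) / (2 * h ^+ 2 + 1)))).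

Definition axis (R : realType) (h : R) (k : 'I_3) (s : bool) : set 'rV[R]_3 :=
  line (axis_point h k) (axis_dir h k s).

(** Radical expressions on which field arithmetic can compute, in place of the
    cosine and sine of a multiple of a third of a turn ([cos_sin_turn]). *)
Definition turn_cos (R : realType) (k : 'I_3) : R :=
  [:: 1; - (1 / 2); - (1 / 2)]`_k.
Definition turn_sin (R : realType) (k : 'I_3) : R :=
  [:: 0; Num.sqrt 3 / 2; - (Num.sqrt 3 / 2)]`_k.

Lemma cos_sin_turn (R : realType) (k : 'I_3) :
  cos (k%:R * (2 * pi / 3) : R) = turn_cos R k /\
  sin (k%:R * (2 * pi / 3) : R) = turn_sin R k.
Proof.
have [c1 s1] := cos_sin_third_turn R.
have s32 : Num.sqrt 3 ^+ 2 = 3 :> R by rewrite sqr_sqrtr.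
rewrite /turn_cos /turn_sin; move: k; apply: ord3P => /=.
- by rewrite mul0r cos0 sin0.
- by rewrite modn_small // mulr1n mul1r c1 s1.
- rewrite !modn_small // -[(1 + 1)%N]/2%N mulr_natl cos_mulr2n sin_mulr2n c1 s1.
  by split; field.
Qed.

Lemma axis_pointE (R : realType) (h : R) (k : 'I_3) :
  axis_point h k = vec3 (turn_cos R k * (horiz_sqnorm h / 4))
                        (turn_sin R k * (horiz_sqnorm h / 4)) 0.
Proof.
have [cE sE] := cos_sin_turn R k.
have -> : horiz_sqnorm h / 4 = 1 / (4 * h ^+ 2 + 2).
  have h20 := sqr_ge0 h; rewrite /horiz_sqnorm; field.
  by rewrite !gt_eqF //; lra.
by apply: row3P; rewrite /axis_point /rotz !vec3E ?cE ?sE; ring.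
Qed.

Lemma horiz_sqnorm_gt0 (R : realType) (h : R) : 0 < horiz_sqnorm h.
Proof. by have h20 := sqr_ge0 h; apply: divr_gt0 => //; lra. Qed.

Lemma vert_sqnormE (R : realType) (h : R) :
  (2 * h ^+ 2 - 1) / (2 * h ^+ 2 + 1) = 1 - horiz_sqnorm h.
Proof.
have h20 := sqr_ge0 h; rewrite /horiz_sqnorm; field.
by rewrite gt_eqF //; lra.
Qed.

Lemma axis_dirE (R : realType) (h : R) (k : 'I_3) (s : bool) :
  axis_dir h k s = vec3 (- turn_sin R k * Num.sqrt (horiz_sqnorm h))
    (turn_cos R k * Num.sqrt (horiz_sqnorm h))
    ((-1) ^+ s * Num.sqrt (1 - horiz_sqnorm h)).
Proof.
have [cE sE] := cos_sin_turn R k.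
by apply: row3P; rewrite /axis_dir vert_sqnormE /rotz !vec3E ?cE ?sE; ring.
Qed.

Lemma threshold_le (R : realType) (h : R) : 0 < h ->
  (Num.sqrt 2 / 2 <= h) = (horiz_sqnorm h <= 1).
Proof.
move=> h_gt0; have h20 := sqr_ge0 h.
rewrite /horiz_sqnorm [RHS]ler_pdivrMr; last lra.
have s2_ge0 : 0 <= Num.sqrt 2 / 2 :> R by rewrite divr_ge0 // sqrtr_ge0.
rewrite -[X in X = _]ler_sqr ?nnegrE ?(ltW h_gt0) // expr_div_n sqr_sqrtr //.
by apply/idP/idP; lra.
Qed.

Lemma threshold_lt (R : realType) (h : R) : 0 < h ->
  (Num.sqrt 2 / 2 < h) = (horiz_sqnorm h < 1).
Proof.
move=> h_gt0; have h20 := sqr_ge0 h.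
rewrite /horiz_sqnorm [RHS]ltr_pdivrMr; last lra.
have s2_ge0 : 0 <= Num.sqrt 2 / 2 :> R by rewrite divr_ge0 // sqrtr_ge0.
rewrite -[X in X = _]ltr_sqr ?nnegrE ?(ltW h_gt0) // expr_div_n sqr_sqrtr //.
by apply/idP/idP; lra.
Qed.

(** With [theta] the angle of [k] thirds of a turn, the last three identities
    say that [sin (3 theta) = 0], [cos (2 theta) = cos theta] and
    [sin (2 theta) = - sin theta]: they express that [3 theta] is a whole number
    of turns. *)
Lemma turn_spec (R : realType) (k : 'I_3) :
  [/\ turn_cos R k ^+ 2 + turn_sin R k ^+ 2 = 1,
      turn_sin R k * (3 * turn_cos R k ^+ 2 - turn_sin R k ^+ 2) = 0,
      turn_cos R k ^+ 2 - turn_sin R k ^+ 2 = turn_cos R k &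
      2 * turn_cos R k * turn_sin R k = - turn_sin R k].
Proof.
have s32 : Num.sqrt 3 ^+ 2 = 3 :> R by rewrite sqr_sqrtr.
rewrite /turn_cos /turn_sin; move: k; apply: ord3P => /=.
- by split; lra.
- by split; [lra| |lra|lra]; rewrite !sqrrN !expr_div_n s32; field.
- by split; [lra| |lra|lra]; rewrite !sqrrN !expr_div_n s32; field.
Qed.

Lemma axis_normal_form (R : realType) (h : R) (k : 'I_3) (s : bool) :
  horiz_sqnorm h <= 1 ->
  dotv (axis_dir h k s) (axis_dir h k s) = 1 /\
  dotv (axis_point h k) (axis_dir h k s) = 0.
Proof.
set w := horiz_sqnorm h.
move=> w1; rewrite axis_pointE axis_dirE !dotvE !vec3E -/w.
have [cs1 _ _ _] := turn_spec R k.
split; last by ring.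
have B2 : Num.sqrt w ^+ 2 = w by rewrite sqr_sqrtr // ltW // horiz_sqnorm_gt0.
have C2 : Num.sqrt (1 - w) ^+ 2 = 1 - w by rewrite sqr_sqrtr // subr_ge0.
transitivity ((turn_cos R k ^+ 2 + turn_sin R k ^+ 2) * Num.sqrt w ^+ 2 +
  ((-1) ^+ s) ^+ 2 * Num.sqrt (1 - w) ^+ 2); first by ring.
by rewrite cs1 sqrr_sign B2 C2 !mul1r addrC subrK.
Qed.

(** Two horizontal parts make an angle of a multiple of a third of a turn, hence
    the factors [1] and [- (1 / 2)]. *)
Lemma axis_dir_dotv (R : realType) (h : R) (k k' : 'I_3) (s s' : bool) :
  horiz_sqnorm h <= 1 ->
  dotv (axis_dir h k s) (axis_dir h k' s') =
  (if k == k' then 1 else - (1 / 2)) * horiz_sqnorm h +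
  (-1) ^+ (s (+) s') * (1 - horiz_sqnorm h).
Proof.
set w := horiz_sqnorm h.
move=> w1; rewrite !axis_dirE !dotvE !vec3E -/w.
have B2 : Num.sqrt w ^+ 2 = w by rewrite sqr_sqrtr // ltW // horiz_sqnorm_gt0.
have C2 : Num.sqrt (1 - w) ^+ 2 = 1 - w by rewrite sqr_sqrtr // subr_ge0.
transitivity ((turn_cos R k * turn_cos R k' + turn_sin R k * turn_sin R k')
  * Num.sqrt w ^+ 2 + (-1) ^+ s * (-1) ^+ s' * Num.sqrt (1 - w) ^+ 2).
  by ring.
rewrite B2 C2 -signr_addb; congr (_ * _ + _).
have s32 : Num.sqrt 3 ^+ 2 = 3 :> R by rewrite sqr_sqrtr.
rewrite /turn_cos /turn_sin.
by move: k'; apply: ord3P; move: k; apply: ord3P => /=; lra.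
Qed.

(** The cubic equation means [a = 0] or [a = +- sqrt 3 b], the three horizontal
    directions [k = 0, 1, 2]; the remaining signs of [b] and [c] are absorbed by
    a global sign [e], which does not change the line, and by [s]. *)
Lemma direction_classification (R : realType) (h : R) (u : 'rV[R]_3) :
  horiz_sqnorm h <= 1 -> dotv u u = 1 ->
  u 0 0 * (3 * u 0 1 ^+ 2 - u 0 0 ^+ 2) = 0 ->
  u 0 0 ^+ 2 + u 0 1 ^+ 2 = horiz_sqnorm h ->
  exists k s (e : bool), u = (-1) ^+ e *: axis_dir h k s.
Proof.
set w := horiz_sqnorm h.
move=> w1 u1 rot wE.
have B2 : Num.sqrt w ^+ 2 = w by rewrite sqr_sqrtr // ltW // horiz_sqnorm_gt0.
have C2 : Num.sqrt (1 - w) ^+ 2 = 1 - w by rewrite sqr_sqrtr // subr_ge0.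
have s32 : Num.sqrt 3 ^+ 2 = 3 :> R by rewrite sqr_sqrtr.
have sq_eq (x y : R) : x ^+ 2 = y ^+ 2 -> exists e : bool, x = (-1) ^+ e * y.
  move/eqP; rewrite eqf_sqr => /orP[]/eqP->.
    by exists false; rewrite mul1r.
  by exists true; rewrite mulN1r.
have [k [e [e0 e1]]] : exists k (e : bool),
    u 0 0 = (-1) ^+ e * (- turn_sin R k * Num.sqrt w) /\
    u 0 1 = (-1) ^+ e * (turn_cos R k * Num.sqrt w).
  move/eqP: rot; rewrite mulf_eq0 => /orP[/eqP a0|/eqP ab].
    have [e bE] : exists e : bool, u 0 1 = (-1) ^+ e * Num.sqrt w.
      by apply: sq_eq; rewrite B2 -wE a0; ring.
    exists 0, e; rewrite /turn_sin /turn_cos /=.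
    by rewrite a0 bE; split; ring.
  have [e bE] : exists e : bool, u 0 1 = (-1) ^+ e * (- (1 / 2) * Num.sqrt w).
    by apply: sq_eq; rewrite exprMn B2 -wE; lra.
  have [e' aE] : exists e : bool, u 0 0 = (-1) ^+ e * (Num.sqrt 3 * u 0 1).
    by apply: sq_eq; rewrite exprMn s32; lra.
  exists (if e' then 2 else 1), e; rewrite /turn_sin /turn_cos.
  by case: e' aE => -> /=; rewrite bE; split; ring.
have [e' e2] : exists e : bool, u 0 2 = (-1) ^+ e * Num.sqrt (1 - w).
  by apply: sq_eq; rewrite C2; rewrite dotvE in u1; lra.
exists k, (e (+) e'), e; apply: row3P; rewrite axis_dirE !mxE /= -/w //.
by rewrite e2 signr_addb mulrA mulrA -expr2 sqrr_sign mul1r.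
Qed.

(** With [horiz_sqnorm h <= 1] on the right-hand side, one equivalence gives
    both the nonexistence below the threshold and the list above it.  The
    direction is known only up to the global sign [e], but the foot [p] is
    quadratic in [u], hence does not depend on it. *)
Lemma circumscribed_axis_classification (R : realType) (h : R)
    (L : set 'rV[R]_3) (rho : R) :
  0 < h -> is_line L -> 0 <= rho ->
  circumscribed (bipyramid_vertices h) (cylinder L rho) <->
  [/\ horiz_sqnorm h <= 1, exists k s, L = axis h k s & rho = circumradius h].
Proof.
set w := horiz_sqnorm h.
move=> h_gt0 /is_line_normal_form[p [u [u1 pu ->]]] rho0.
have cr0 : 0 <= circumradius h.
  by have h20 := sqr_ge0 h; apply: divr_ge0; lra.
have rhoE : rho ^+ 2 = circumradius h ^+ 2 <-> rho = circumradius h.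
  by split=> [/eqP|->//]; rewrite eqrXn2 // => /eqP.
split.
  move=> /(circumscribedE _ _ u1 rho0) /(equidistant_bipyramid _ h_gt0 u1 pu).
  move=> [pE rot wE /rhoE->].
  have w1 : w <= 1.
    have := sqr_ge0 (u 0 2); rewrite -/w in wE; rewrite dotvE in u1; lra.
  split=> //.
  have [k [s [e uE]]] := direction_classification w1 u1 rot wE.
  exists k, s; rewrite /axis.
  have -> : p = axis_point h k.
    have B2 : Num.sqrt w ^+ 2 = w.
      by rewrite sqr_sqrtr // ltW // horiz_sqnorm_gt0.
    have e2 : ((-1) ^+ e) ^+ 2 = 1 :> R by rewrite sqrr_sign.
    have [_ _ c2 s2] := turn_spec R k.
    rewrite pE axis_pointE uE axis_dirE -/w.
    apply: row3P; rewrite !mxE //=.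
      transitivity (((-1) ^+ e) ^+ 2 * (turn_cos R k ^+ 2 - turn_sin R k ^+ 2)
         * (Num.sqrt w ^+ 2) / 4); first by ring.
      by rewrite e2 c2 B2; ring.
    transitivity (- ((-1) ^+ e) ^+ 2 * (2 * turn_cos R k * turn_sin R k)
       * (Num.sqrt w ^+ 2) / 4); first by field.
    by rewrite e2 s2 B2; ring.
  rewrite uE -[RHS](@line_reparam _ _ _ 0 ((-1) ^+ e)) ?signr_eq0 //.
  by rewrite scale0r addr0.
move=> [w1 [k [s ->]] ->].
have [v1 qv] := axis_normal_form k s w1.
apply/(circumscribedE _ _ v1 cr0)/(equidistant_bipyramid _ h_gt0 v1 qv).
have B2 : Num.sqrt w ^+ 2 = w by rewrite sqr_sqrtr // ltW // horiz_sqnorm_gt0.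
have [cs1 cs2 c2 s2] := turn_spec R k.
rewrite axis_pointE !axis_dirE !vec3E -/w.
split=> //.
- apply: row3P; rewrite !vec3E //.
    transitivity ((turn_cos R k ^+ 2 - turn_sin R k ^+ 2)
       * (Num.sqrt w ^+ 2) / 4); last by ring.
    by rewrite c2 B2; ring.
  transitivity (- (2 * turn_cos R k * turn_sin R k)
     * (Num.sqrt w ^+ 2) / 4); last by field.
  by rewrite s2 B2; ring.
- transitivity (- Num.sqrt w ^+ 3 * (turn_sin R k *
    (3 * turn_cos R k ^+ 2 - turn_sin R k ^+ 2))); first by ring.
  by rewrite cs2 mulr0.
- transitivity ((turn_cos R k ^+ 2 + turn_sin R k ^+ 2) * Num.sqrt w ^+ 2);
    first by ring.
  by rewrite cs1 B2 mul1r.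
Qed.

(** * Counting the cylinders *)

Lemma line_sub_cylinder (R : realType) (p u : 'rV[R]_3) (rho : R) :
  dotv u u = 1 -> 0 <= rho -> line p u `<=` cylinder (line p u) rho.
Proof.
move=> u1 rho0 _ [t _ <-]; rewrite cylinder_lineE //=.
rewrite (_ : axis_sqdist _ _ _ = t ^+ 2 * dotv u u - (t * dotv u u) ^+ 2).
  by rewrite u1 !mulr1 subrr sqr_ge0.
by rewrite /axis_sqdist !dotvE !mxE; ring.
Qed.

(** Along the line directed by [u'] the squared distance to the axis is a
    quadratic polynomial of the parameter with leading coefficient
    [1 - (u.u')^2], so it can be bounded only if this coefficient is [<= 0].
    By Cauchy-Schwarz the conclusion means that [u] and [u'] are parallel. *)
Lemma parallel_of_line_sub_cylinder (R : realType) (p u p' u' : 'rV[R]_3)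
    (rho : R) :
  dotv u u = 1 -> dotv u' u' = 1 -> 0 <= rho ->
  line p' u' `<=` cylinder (line p u) rho -> 1 <= dotv u u' ^+ 2.
Proof.
move=> u1 u1' rho0; rewrite cylinder_lineE // => sub.
rewrite -subr_le0 leNgt; apply/negP.
set m := 1 - _ => m0.
(* Adding the values at [t] and [- t] eliminates the linear term. *)
have le t : t ^+ 2 * m <= rho ^+ 2.
  have lep : axis_sqdist p u (p' + t *: u') <= rho ^+ 2 by apply: sub; exists t.
  have len : axis_sqdist p u (p' + (- t) *: u') <= rho ^+ 2.
    by apply: sub; exists (- t).
  have ge := axis_sqdist_ge0 p p' u1.
  have : axis_sqdist p u (p' + t *: u') + axis_sqdist p u (p' + (- t) *: u') =
      2 * axis_sqdist p u p' + 2 * (t ^+ 2 * m).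
    have -> : m = dotv u' u' - dotv u u' ^+ 2 by rewrite u1'.
    by rewrite /axis_sqdist !dotvE !mxE; ring.
  lra.
(* A parameter large enough to exceed the bound: [t ^+ 2 * m > 2 * (r + 1)]. *)
have := le ((rho ^+ 2 + 1) / m + 1).
have r0 := sqr_ge0 rho; set r := rho ^+ 2 in r0 *.
have q0 : 0 <= (r + 1) / m by rewrite divr_ge0 ?(ltW m0) //; lra.
have qm : (r + 1) / m * m = r + 1 by rewrite divfK // gt_eqF.
have := mulr_ge0 (mulr_ge0 q0 q0) (ltW m0).
by move: q0 qm; move: ((r + 1) / m) => q q0 qm h1 h2; lra.
Qed.

(** The inner product of two of the six directions is [d w +- (1 - w)], where
    [w = horiz_sqnorm h] and [d] is [1] or [- 1 / 2].  It is [1] or [- 1] only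
    for two equal directions, or for [d = 1] and [w = 1]: the latter is the
    threshold, where the sign [s] has no effect. *)
Lemma axis_cylinder_inj (R : realType) (h rho : R) (k k' : 'I_3) (s s' : bool) :
  Num.sqrt 2 / 2 <= h -> 0 <= rho ->
  cylinder (axis h k s) rho = cylinder (axis h k' s') rho ->
  k = k' /\ (Num.sqrt 2 / 2 < h -> s = s').
Proof.
move=> hle rho0 cylE.
have h0 : 0 < h by apply: lt_le_trans hle; rewrite divr_gt0 // sqrtr_gt0.
have w0 := horiz_sqnorm_gt0 h.
rewrite threshold_le // in hle; rewrite threshold_lt //.
have [v1 _] := axis_normal_form k s hle.
have [v1' _] := axis_normal_form k' s' hle.
have := @parallel_of_line_sub_cylinder R (axis_point h k) (axis_dir h k s)
  (axis_point h k') (axis_dir h k' s') rho v1 v1' rho0.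
rewrite -/(axis h k s) cylE => /(_ (line_sub_cylinder v1' rho0)).
rewrite axis_dir_dotv //.
have sq_lt1 (d : R) : -1 < d -> d < 1 -> 1 <= d ^+ 2 -> False.
  move=> d1 d2 d3; have : 0 < (d + 1) * (1 - d) by rewrite mulr_gt0 //; lra.
  lra.
have [->|kk'] := eqVneq k k'; last first.
  by case: (s (+) s'); rewrite ?expr0 ?expr1 => /sq_lt1 []; lra.
case: s s' {cylE v1 v1'} => -[] //= sq; split=> // w1; exfalso;
  move: sq; rewrite ?expr0 ?expr1; apply: sq_lt1; lra.
Qed.

Lemma circumscribed_cylindersE (R : realType) (h : R) :
  Num.sqrt 2 / 2 <= h ->
  circumscribed_cylinders (bipyramid_vertices h) =
  [set cylinder (axis h ks.1 ks.2) (circumradius h) | ks in [set: 'I_3 * bool]].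
Proof.
move=> hle.
have h0 : 0 < h by apply: lt_le_trans hle; rewrite divr_gt0 // sqrtr_gt0.
have cr0 : 0 <= circumradius h.
  by have h20 := sqr_ge0 h; apply: divr_ge0; lra.
have lin k s : is_line (axis h k s).
  exists (axis_point h k), (axis_dir h k s); split=> //.
  have [] := @axis_normal_form R h k s; first by rewrite -threshold_le.
  move=> v1 _; apply/eqP => v0; move: v1; rewrite v0 dotvE !mxE.
  by rewrite !mul0r !addr0 => /eqP; rewrite eq_sym oner_eq0.
apply/seteqP; split=> [_ [[L [rho [lL rho0 ->]]]]|_ [[k s] _ <-]].
  move=> /(circumscribed_axis_classification h0 lL rho0)[_ [k [s ->]] ->].
  by exists (k, s).
split; first by exists (axis h k s), (circumradius h).
apply/(circumscribed_axis_classification h0 (lin k s) cr0).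
by rewrite -threshold_le //; split=> //; exists k, s.
Qed.

Lemma card_setT_II (T : finType) : [set: T] #= `I_#|T|.
Proof.
apply: card_eq_trans (_ : _ #= [set: 'I_#|T|]) _; last first.
  by rewrite card_eq_sym card_II.
have <- : enum_rank @` [set: T] = [set: 'I_#|T|].
  by apply/seteqP; split=> // i _; exists (enum_val i) => //; rewrite enum_valK.
by rewrite card_eq_sym; apply: inj_card_eq => x y _ _; apply: enum_rank_inj.
Qed.

Lemma card_circumscribed_cylinders (R : realType) (h : R) :
  Num.sqrt 2 / 2 < h ->
  circumscribed_cylinders (bipyramid_vertices h) #= `I_6.
Proof.
move=> hlt; have h20 := sqr_ge0 h.
rewrite circumscribed_cylindersE ?ltW //.
have -> : 6%N = #|{: 'I_3 * bool}| by rewrite card_prod card_ord card_bool.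
apply: card_eq_trans (card_setT_II _); apply: inj_card_eq => -[k s] [k' s'] _ _.
move=> /axis_cylinder_inj[]; [exact: ltW | apply: divr_ge0; lra|].
by move=> /= -> /(_ hlt) ->.
Qed.

Lemma card_circumscribed_cylinders_threshold (R : realType) (h : R) :
  h = Num.sqrt 2 / 2 ->
  circumscribed_cylinders (bipyramid_vertices h) #= `I_3.
Proof.
move=> hE; have hle : Num.sqrt 2 / 2 <= h by rewrite hE.
have h20 := sqr_ge0 h.
rewrite circumscribed_cylindersE //.
have hh : 2 * h ^+ 2 - 1 = 0.
  by rewrite hE expr_div_n sqr_sqrtr //; field.
have w1 : 1 - horiz_sqnorm h = 0 by rewrite -vert_sqnormE hh mul0r.
have -> : [set cylinder (axis h ks.1 ks.2) (circumradius h) |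
             ks in [set: 'I_3 * bool]] =
          [set cylinder (axis h k false) (circumradius h) | k in [set: 'I_3]].
  have sign_irr k s : axis h k s = axis h k false.
    by rewrite /axis !axis_dirE w1 sqrtr0 !mulr0.
  apply/seteqP; split=> [_ [[k s] _ <-]|_ [k _ <-]].
    by exists k => //=; rewrite (sign_irr k s).
  by exists (k, false).
have card3 : [set: 'I_3] #= `I_3 by rewrite card_eq_sym card_II.
apply: card_eq_trans card3.
apply: inj_card_eq => k k' _ _ /axis_cylinder_inj[] //.
by apply: divr_ge0; lra.
Qed.

Theorem theorem5 (R : realType) (h : R) (h_gt0 : 0 < h) :
  (h < Num.sqrt 2 / 2 ->
     circumscribed_cylinders (bipyramid_vertices h) = set0)
  /\
  (Num.sqrt 2 / 2 <= h ->
     [/\ forall (L : set 'rV[R]_3) (rho : R), is_line L -> 0 <= rho ->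
           (circumscribed (bipyramid_vertices h) (cylinder L rho) <->
            (exists (k : 'I_3) (s : bool),
               L = rotz (k%:R * (2 * pi / 3)) @`
                     line (vec3 (1 / (4 * h ^+ 2 + 2)) 0 0)
                          (vec3 0
                             (Num.sqrt (2 / (2 * h ^+ 2 + 1)))
                             ((-1) ^+ s *
                              Num.sqrt ((2 * h ^+ 2 - 1) / (2 * h ^+ 2 + 1)))))
            /\ rho = (4 * h ^+ 2 + 1) / (4 * h ^+ 2 + 2)),
         Num.sqrt 2 / 2 < h ->
           circumscribed_cylinders (bipyramid_vertices h) #= `I_6
       & h = Num.sqrt 2 / 2 ->
           circumscribed_cylinders (bipyramid_vertices h) #= `I_3]).
Proof.
split=> [hlt|hle].
  apply/seteqP; split=> // _ [[L [rho [lL rho0 ->]]]].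
  move=> /(circumscribed_axis_classification h_gt0 lL rho0)[].
  by rewrite -threshold_le // leNgt hlt.
split; [|exact: card_circumscribed_cylinders|
         exact: card_circumscribed_cylinders_threshold].
move=> L rho lL rho0.
rewrite (circumscribed_axis_classification h_gt0 lL rho0) -threshold_le //.
split=> [[_ [k [s ->]] ->]|[[k [s ->]] ->]].
  by split=> //; exists k, s; rewrite rotz_line.
by split=> //; exists k, s; rewrite rotz_line.
Qed.
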